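(* Let $\Sigma=\{a_1,\ldots,a_\sigma\}$ be a finite ordered alphabet of constant size $\sigma$. There is an algorithm which, given a word $w\in\Sigma^*$ of length $n$, computes the set of all full Abelian periods of $w$ in time $O(n\log\log n)$ and space $O(n)$.
   Context: For a word $w$ over $\Sigma$, its Parikh vector is $\mathcal{P}_w=(|w|_{a_1},\ldots,|w|_{a_\sigma})$, where $|w|_a$ is the number of occurrences of the letter $a$ in $w$. A positive integer $p$ is a full Abelian period of $w$ if $w$ can be written as $w=u_1u_2\cdots u_m$ with $m\geq 1$, $|u_i|=p$ for all $i$, and $\mathcal{P}_{u_1}=\mathcal{P}_{u_2}=\cdots=\mathcal{P}_{u_m}$ (equivalently, an Abelian period with empty head and empty tail). In particular a full Abelian period divides $n=|w|$, and $n$ itself is always a full Abelian period. *)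

(* Defs.v *)
From mathcomp Require Import all_boot.

Set Implicit Arguments.
Unset Strict Implicit.
Unset Printing Implicit Defensive.

Definition parikh (sigma : nat) (w : seq 'I_sigma) : {ffun 'I_sigma -> nat} :=
  [ffun a => count_mem a w].

Definition full_abelian_period (sigma : nat) (w : seq 'I_sigma) (p : nat) : Prop :=
  0 < p /\
  exists us : seq (seq 'I_sigma),
    [/\ w = flatten us,
        0 < size us,
        (forall u, u \in us -> size u = p) &
        (forall u v, u \in us -> v \in us -> parikh u = parikh v)].

(* A word RAM: a fixed finite program, a register file addressed only by the
   constants occurring in the program (hence O(1) registers), and an indirectly
   addressed memory of [cells] words of [bits] bits each.  A step costs one unit
   of time; a step that produces a value that does not fit in a word, or
   addresses a cell outside the memory, is an error.  Subtraction is truncated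
   at 0, and the quotient by 0 is 0. *)

Variant binop := Add | Sub | Mul | Div.

Definition eval_binop (op : binop) : nat -> nat -> nat :=
  match op with Add => addn | Sub => subn | Mul => muln | Div => divn end.

Variant instr :=
  | Const (r k : nat)                 (* R[r] := k                     *)
  | Op (op : binop) (r a b : nat)     (* R[r] := R[a] op R[b]          *)
  | Read (r a : nat)                  (* R[r] := M[R[a]]               *)
  | Write (a b : nat)                 (* M[R[a]] := R[b]               *)
  | Jump (l : nat)                    (* goto l                        *)
  | JumpLt (a b l : nat)              (* if R[a] < R[b] then goto l    *)
  | Halt.

Definition program := seq instr.

Record config := Config { pc : nat; regs : nat -> nat; memory : nat -> nat }.

Definition upd (f : nat -> nat) (i v : nat) : nat -> nat :=
  fun j => if j == i then v else f j.

Definition set_reg (bits : nat) (c : config) (r v : nat) : option config :=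
  if v < 2 ^ bits then Some (Config (pc c).+1 (upd (regs c) r v) (memory c))
  else None.

Definition ram_step (cells bits : nat) (P : program) (c : config) : option config :=
  match onth P (pc c) with
  | Some (Const r k) => set_reg bits c r k
  | Some (Op op r a b) => set_reg bits c r (eval_binop op (regs c a) (regs c b))
  | Some (Read r a) =>
      if regs c a < cells then set_reg bits c r (memory c (regs c a)) else None
  | Some (Write a b) =>
      if regs c a < cells
      then Some (Config (pc c).+1 (regs c) (upd (memory c) (regs c a) (regs c b)))
      else None
  | Some (Jump l) => Some (Config l (regs c) (memory c))
  | Some (JumpLt a b l) =>
      Some (Config (if regs c a < regs c b then l else (pc c).+1) (regs c) (memory c))
  | Some Halt | None => None
  end.

Definition ram_steps (cells bits : nat) (P : program) (t : nat) (c : config) :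
    option config :=
  iter t (obind (ram_step cells bits P)) (Some c).

(* The input x occupies the cells 0, ..., size x - 1, its length is in register
   0, and all other cells and registers are 0. *)
Definition ram_init (x : seq nat) : config :=
  Config 0 (upd (fun=> 0) 0 (size x)) (nth 0 x).

(* On halting, register 0 holds the length of the output, which is stored in the
   first cells of the memory. *)
Definition ram_output (c : config) : seq nat := mkseq (memory c) (regs c 0).

Definition ram_computes (cells bits : nat) (P : program)
    (x : seq nat) (t : nat) (y : seq nat) : Prop :=
  [/\ size x <= cells, size x < 2 ^ bits, all (fun v => v < 2 ^ bits) x &
      exists c, [/\ ram_steps cells bits P t (ram_init x) = Some c,
                    onth P (pc c) = Some Halt,
                    regs c 0 <= cells & ram_output c = y]].

(* Main.v *)
Require Import Defs.
From mathcomp Require Import all_boot all_order all_algebra.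
From mathcomp Require Import all_classical all_reals all_analysis.
From mathcomp Require Import zify ring lra.
Import Order.TTheory GRing.Theory Num.Theory.
Import numFieldNormedType.Exports.

Set Implicit Arguments.
Unset Strict Implicit.
Unset Printing Implicit Defensive.

(* Call a position i of the word w of length n bad if, for some letter a, the
   prefix of length i does not contain the letter a in the proportion i / n, that
   is, |w[0..i)|_a * n <> i * |w|_a.  A divisor d of n is a full Abelian period
   iff no multiple of d up to n is bad.  The bad positions are found in linear
   time.  The flags "some multiple of i is bad" are then computed along with the
   sieve of Eratosthenes: for each prime p <= n and for k from n / p down to 1,
   flag k inherits flag k * p.  This costs the sum of n / p over the primes
   p <= n.  The primes between 2^j and 2^(j+1) divide the binomial coefficient
   of 2^(j+1) over 2^j, hence number at most 2^(j+1) / j and contribute at most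
   2n / j to that sum; summing the harmonic series over j <= log n yields
   O(n log log n).  Flags and input take 3n + 1 cells. *)

(** * The sum of n / p over the primes p *)

(** Distinct primes are coprime, so each one is coprime to the product of the others and Gauss's
    lemma applies. *)
Lemma prod_primes_dvdn (s : seq nat) (m : nat) :
  uniq s -> (forall p, p \in s -> prime p && (p %| m)) -> \prod_(p <- s) p %| m.
Proof.
elim: s => [|p s IHs] /=; first by rewrite big_nil dvd1n.
case/andP=> p_notin_s uniq_s dvd_s; rewrite big_cons Gauss_dvd; last first.
  have /andP[pr_p _] := dvd_s p (mem_head _ _).
  rewrite big_seq; apply: (big_rec (fun x => coprime p x)) => [|q x q_s co_px].
    exact: coprimen1.
  have /andP[pr_q _] : prime q && (q %| m) by apply: dvd_s; rewrite inE q_s orbT.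
  rewrite coprimeMr co_px prime_coprime // dvdn_prime2 // andbT.
  by apply: contraNneq p_notin_s => ->.
have /andP[_ ->] := dvd_s p (mem_head _ _).
by apply: IHs => // q q_s; apply: dvd_s; rewrite inE q_s orbT.
Qed.

Lemma prime_dvdn_fact (p m : nat) : prime p -> (p %| m`!) = (p <= m).
Proof.
move=> pr_p; apply/idP/idP => [|le_pm]; last by rewrite dvdn_fact // prime_gt0.
elim: m => [|m IHm]; first by rewrite fact0 dvdn1 => /eqP p1; rewrite p1 in pr_p.
by rewrite factS Euclid_dvdM // => /orP[/dvdn_leq->//|/IHm /leqW].
Qed.

(** Such a prime divides the factorial of [m.*2], which is the binomial times the square of the
    factorial of [m], but it is too large to divide the latter. *)
Lemma prime_dvdn_central_bin (p m : nat) :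
  prime p -> m < p <= m.*2 -> p %| 'C(m.*2, m).
Proof.
move=> pr_p /andP[lt_mp le_p].
have := prime_dvdn_fact m.*2 pr_p; rewrite le_p.
rewrite -(@bin_fact m.*2 m); last lia.
rewrite !Euclid_dvdM // !prime_dvdn_fact //.
have -> : m.*2 - m = m by lia.
by rewrite [p <= m]leqNgt lt_mp /= orbF.
Qed.

Lemma leq_bin_exp2 (n m : nat) : 'C(n, m) <= 2 ^ n.
Proof.
elim: n m => [|n IHn] [|m]; rewrite ?bin0 ?expn_gt0 //.
by rewrite binS expnS mul2n -addnn leq_add.
Qed.

(** Chebyshev's argument: the primes counted all exceed [m], and their product divides the central
    binomial coefficient. *)
Lemma expn_count_prime (m : nat) :
  m ^ count prime (index_iota m.+1 m.*2.+1) <= 2 ^ m.*2.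
Proof.
apply: leq_trans (leq_bin_exp2 m.*2 m).
set s := [seq p <- index_iota m.+1 m.*2.+1 | prime p].
have mem_s p : p \in s -> prime p && (m < p <= m.*2).
  by rewrite mem_filter mem_index_iota ltnS.
apply: (@leq_trans (\prod_(p <- s) p)); last first.
  apply: dvdn_leq; first by rewrite bin_gt0; lia.
  apply: prod_primes_dvdn; first by rewrite filter_uniq // iota_uniq.
  move=> p /mem_s /andP[pr_p m_p]; rewrite pr_p; exact: prime_dvdn_central_bin.
rewrite -size_filter -/s; elim: s mem_s => [|p s IHs] mem_s; first by rewrite big_nil.
rewrite big_cons /= expnS leq_mul //.
  by have /and3P[_ /ltnW] := mem_s p (mem_head _ _).
by apply: IHs => q q_s; apply: mem_s; rewrite inE q_s orbT.
Qed.

(** For [m = 2 ^ j], Chebyshev's bound says that [j] times the number of primes is at most [m.*2].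
    Each term is at most [n %/ m], so [m] cancels. *)
Lemma sum_prime_divn_dyadic (n j : nat) :
  0 < j -> \sum_((2 ^ j).+1 <= p < (2 ^ j.+1).+1 | prime p) n %/ p <= n.*2 %/ j.
Proof.
move=> j_gt0; set m := 2 ^ j.
have m_gt0 : 0 < m by rewrite expn_gt0.
have -> : 2 ^ j.+1 = m.*2 by rewrite expnS mul2n.
have le_count : j * count prime (index_iota m.+1 m.*2.+1) <= m.*2.
  by rewrite -(@leq_exp2l 2) // expnM expn_count_prime.
apply: (@leq_trans (\sum_(m.+1 <= p < m.*2.+1 | prime p) n %/ m)).
  rewrite big_nat_cond [leqRHS]big_nat_cond; apply: leq_sum => p /andP[/andP[lt_mp _] _].
  by apply: leq_div2l => //; apply: ltnW.
rewrite big_const_seq iter_addn_0 leq_divRL //.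
set c := count _ _ in le_count *.
rewrite -mulnA (mulnC c); apply: leq_trans (leq_mul (leqnn _) le_count) _.
by rewrite -doubleMr leq_double leq_divM.
Qed.

(** Each dyadic block has [2 ^ r] terms, none above [n %/ 2 ^ r], and so adds at most [n]. *)
Lemma sum_divn_expn2 (n r : nat) : \sum_(1 <= j < 2 ^ r) n %/ j <= n * r.
Proof.
elim: r => [|r IHr]; first by rewrite big_geq.
have r2 : 0 < 2 ^ r by rewrite expn_gt0.
rewrite (@big_cat_nat _ _ _ (2 ^ r)) ?leq_exp2l //= mulnS addnC leq_add //.
apply: (@leq_trans (\sum_(2 ^ r <= j < 2 ^ r.+1) n %/ 2 ^ r)).
  rewrite big_nat_cond [leqRHS]big_nat_cond; apply: leq_sum => j /andP[/andP[le_j _] _].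
  exact: leq_div2l.
by rewrite sum_nat_const_nat expnS mul2n -addnn addnK mulnC leq_divM.
Qed.

(** The first block contains only the prime 2 and is bounded by [n] directly, as the dyadic bound
    requires [0 < j]. *)
Lemma sum_prime_divn_expn2 (n k : nat) :
  \sum_(2 <= p < (2 ^ k).+1 | prime p) n %/ p <= n + \sum_(1 <= j < k) n.*2 %/ j.
Proof.
elim: k => [|[|k] IHk]; first by rewrite big_geq.
  by rewrite expn1 big_mkcond big_nat1 /=; have := leq_div n 2; lia.
rewrite big_nat_recr //= addnA (@big_cat_nat _ _ _ (2 ^ k.+1).+1) /=; last 2 first.
- by rewrite ltnS expn_gt0.
- by rewrite ltnS leq_exp2l.
by rewrite leq_add // sum_prime_divn_dyadic.
Qed.

Lemma sum_prime_divn (n : nat) :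
  \sum_(2 <= p < n.+1 | prime p) n %/ p <= n * (up_log 2 (up_log 2 n)).*2.+1.
Proof.
set k := up_log 2 n; set r := up_log 2 k.
have le_n : n <= 2 ^ k by apply: up_logP.
have le_k : k <= 2 ^ r by apply: up_logP.
have := sum_prime_divn_expn2 n k; have := sum_divn_expn2 n.*2 r.
case: (posnP n) => [n0 _ _|n_gt0]; first by rewrite [in leqLHS]big_geq ?n0.
(* Both summation ranges are extended up to a power of two: the primes to [2 ^ k], the harmonic sum
   to [2 ^ r]. *)
have le_sub (F : nat -> nat) (P : pred nat) a b c : a <= b <= c ->
    \sum_(a <= i < b | P i) F i <= \sum_(a <= i < c | P i) F i.
  by case/andP=> ab bc; rewrite [leqRHS](@big_cat_nat _ _ _ b) //= leq_addr.
move=> le_j le_p; rewrite mulnS.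
apply: leq_trans (leq_trans le_p _); first by apply: le_sub; rewrite ltnS n_gt0.
rewrite leq_add2l -doubleMr doubleMl; apply: leq_trans le_j.
by case: (k) le_k => [|k'] ?; [rewrite big_geq | apply: le_sub].
Qed.

(** * Structured programs for the word RAM *)

Inductive cmd :=
  | Do (i : instr)
  | Seq (c1 c2 : cmd)
  | IfLt (a b : nat) (c : cmd)
  | WhileLt (a b : nat) (c : cmd).

Fixpoint csize (c : cmd) : nat :=
  match c with
  | Do _ => 1
  | Seq c1 c2 => csize c1 + csize c2
  | IfLt _ _ c => (csize c).+2
  | WhileLt _ _ c => (csize c).+3
  end.

(** Jump targets are absolute, so the translation depends on the address [l] of its first
    instruction. A test becomes two jumps: the conditional one enters the body, the unconditional
    one after it leaves. *)
Fixpoint compile (l : nat) (c : cmd) : program :=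
  match c with
  | Do i => [:: i]
  | Seq c1 c2 => compile l c1 ++ compile (l + csize c1) c2
  | IfLt a b c => [:: JumpLt a b l.+2, Jump (l + (csize c).+2) & compile l.+2 c]
  | WhileLt a b c =>
      [:: JumpLt a b l.+2, Jump (l + (csize c).+3) & rcons (compile l.+2 c) (Jump l)]
  end.

Lemma size_compile (l : nat) (c : cmd) : size (compile l c) = csize c.
Proof.
elim: c l => //= [c1 IH1 c2 IH2|a b c IHc|a b c IHc] l.
- by rewrite size_cat IH1 IH2.
- by rewrite IHc.
- by rewrite size_rcons IHc.
Qed.

Definition code_at (P : program) (l : nat) (s : program) : Prop :=
  forall i x, onth s i = Some x -> onth P (l + i) = Some x.

Lemma code_at_cons (P : program) (l : nat) (x : instr) (s : program) :
  code_at P l (x :: s) -> onth P l = Some x /\ code_at P l.+1 s.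
Proof.
move=> H; split; first by have := H 0 x erefl; rewrite addn0.
by move=> i y si; rewrite addSnnS; apply: H.
Qed.

Lemma code_at_cat (P : program) (l : nat) (s1 s2 : program) :
  code_at P l (s1 ++ s2) -> code_at P l s1 /\ code_at P (l + size s1) s2.
Proof.
move=> H; split=> i x si.
  apply: H; rewrite onth_cat ifT // -onthTE; by rewrite si.
by rewrite -addnA; apply: H; rewrite onth_cat ltnNge leq_addr /= addKn.
Qed.

Section Runs.

Variables cells bits : nat.

(** Total correctness with the exact step count passed to the postcondition. Quantifying over all
    programs that contain the code at any address lets the rules below compose. *)
Definition runs (c : cmd) (R M : nat -> nat)
    (Q : nat -> (nat -> nat) -> (nat -> nat) -> Prop) : Prop :=
  forall P l, code_at P l (compile l c) ->
  exists t R' M',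
    ram_steps cells bits P t (Config l R M) = Some (Config (l + csize c) R' M')
    /\ Q t R' M'.

Lemma ram_stepsD (P : program) (t1 t2 : nat) (c c1 : config) :
  ram_steps cells bits P t1 c = Some c1 ->
  ram_steps cells bits P (t1 + t2) c = ram_steps cells bits P t2 c1.
Proof. by rewrite /ram_steps addnC iterD => ->. Qed.

Lemma ram_stepsS (P : program) (t : nat) (c c1 : config) :
  ram_step cells bits P c = Some c1 ->
  ram_steps cells bits P t.+1 c = ram_steps cells bits P t c1.
Proof. by move=> step; rewrite -add1n; apply: ram_stepsD. Qed.

Lemma ram_step_jump (P : program) (l l' : nat) (R M : nat -> nat) :
  onth P l = Some (Jump l') ->
  ram_step cells bits P (Config l R M) = Some (Config l' R M).
Proof. by rewrite /ram_step /= => ->. Qed.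

Lemma runs_weaken (c : cmd) R M (Q Q' : nat -> (nat -> nat) -> (nat -> nat) -> Prop) :
  runs c R M Q -> (forall t R' M', Q t R' M' -> Q' t R' M') -> runs c R M Q'.
Proof.
move=> run_c QQ' P l /run_c[t [R' [M' [steps Qt]]]].
by exists t, R', M'; split=> //; apply: QQ'.
Qed.

Lemma runs_const r k R M (Q : nat -> (nat -> nat) -> (nat -> nat) -> Prop) :
  k < 2 ^ bits -> Q 1 (upd R r k) M -> runs (Do (Const r k)) R M Q.
Proof.
move=> lt_k Q1 P l /code_at_cons[Pl _]; exists 1, (upd R r k), M; split=> //.
by rewrite /ram_steps /= /ram_step /= Pl /set_reg lt_k addn1.
Qed.

Lemma runs_op op r a b R M (Q : nat -> (nat -> nat) -> (nat -> nat) -> Prop) :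
  eval_binop op (R a) (R b) < 2 ^ bits ->
  Q 1 (upd R r (eval_binop op (R a) (R b))) M -> runs (Do (Op op r a b)) R M Q.
Proof.
move=> lt_v Q1 P l /code_at_cons[Pl _]; eexists 1, _, M; split; last exact: Q1.
by rewrite /ram_steps /= /ram_step /= Pl /set_reg /= lt_v addn1.
Qed.

Lemma runs_read r a R M (Q : nat -> (nat -> nat) -> (nat -> nat) -> Prop) :
  R a < cells -> M (R a) < 2 ^ bits ->
  Q 1 (upd R r (M (R a))) M -> runs (Do (Read r a)) R M Q.
Proof.
move=> lt_a lt_v Q1 P l /code_at_cons[Pl _]; eexists 1, _, M; split; last exact: Q1.
by rewrite /ram_steps /= /ram_step /= Pl /set_reg /= lt_a lt_v addn1.
Qed.

Lemma runs_write a b R M (Q : nat -> (nat -> nat) -> (nat -> nat) -> Prop) :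
  R a < cells -> Q 1 R (upd M (R a) (R b)) -> runs (Do (Write a b)) R M Q.
Proof.
move=> lt_a Q1 P l /code_at_cons[Pl _]; eexists 1, R, _; split; last exact: Q1.
by rewrite /ram_steps /= /ram_step /= Pl lt_a addn1.
Qed.

Lemma runs_seq c1 c2 R M (Q : nat -> (nat -> nat) -> (nat -> nat) -> Prop) :
  runs c1 R M (fun t1 R1 M1 => runs c2 R1 M1 (fun t2 => Q (t1 + t2))) ->
  runs (Seq c1 c2) R M Q.
Proof.
move=> run12 P l /code_at_cat[/run12[t1 [R1 [M1 [steps1 run2]]]]].
rewrite size_compile => /run2[t2 [R2 [M2 [steps2 Q12]]]].
by exists (t1 + t2), R2, M2; rewrite (ram_stepsD _ steps1) /= addnA.
Qed.

Lemma runs_if a b c R M (Q : nat -> (nat -> nat) -> (nat -> nat) -> Prop) :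
  (R a < R b -> runs c R M (fun t => Q t.+1)) -> (R b <= R a -> Q 2 R M) ->
  runs (IfLt a b c) R M Q.
Proof.
move=> run_c Q2 P l /code_at_cons[Pl /code_at_cons[Pl1 Plc]].
have step : ram_step cells bits P (Config l R M) =
    Some (Config (if R a < R b then l.+2 else l.+1) R M).
  by rewrite /ram_step /= Pl.
case: ltnP step => [/run_c run|/Q2 {}Q2] step.
  have [t [R' [M' [steps Qt]]]] := run _ _ Plc.
  by exists t.+1, R', M'; rewrite (ram_stepsS _ step) steps /= !addnS !addSn.
by exists 2, R, M; rewrite (ram_stepsS _ step) (ram_stepsS _ (ram_step_jump _ _ Pl1)).
Qed.

(** The number [N] of rounds is fixed in advance and the invariant is indexed by the rounds done.
    Each round pays two extra steps, for the test and the jump back; leaving the loop pays two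
    more. *)
Lemma runs_while a b c N (T : nat -> nat) (I : nat -> (nat -> nat) -> (nat -> nat) -> Prop)
    R M :
  (forall k R M, k < N -> I k R M ->
     R a < R b /\ runs c R M (fun t R' M' => t <= T k /\ I k.+1 R' M')) ->
  (forall R M, I N R M -> R b <= R a) -> I 0 R M ->
  runs (WhileLt a b c) R M
    (fun t R' M' => t <= \sum_(k < N) (T k).+2 + 2 /\ I N R' M').
Proof.
move=> body exit I0 P l /code_at_cons[Pl /code_at_cons[Pl1]].
rewrite -cats1 => /code_at_cat[Plc]; rewrite size_compile => /code_at_cons[Pback _].
have step R1 M1 : ram_step cells bits P (Config l R1 M1) =
    Some (Config (if R1 a < R1 b then l.+2 else l.+1) R1 M1).
  by rewrite /ram_step /= Pl.
(* Induction on the number [d] of remaining rounds, from an arbitrary round [k]. *)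
suff loop d k R1 M1 : N = k + d -> I k R1 M1 -> exists t R' M',
    [/\ ram_steps cells bits P t (Config l R1 M1) =
          Some (Config (l + (csize c).+3) R' M'),
        t <= \sum_(k <= j < N) (T j).+2 + 2 & I N R' M'].
  have [t [R' [M' [steps le_t IN]]]] := loop N 0 R M erefl I0.
  by exists t, R', M'; rewrite big_mkord in le_t.
elim: d k R1 M1 => [|d IHd] k R1 M1.
  rewrite addn0 => <- IN; exists 2, R1, M1; split=> //; last by rewrite big_geq.
  have step1 := step R1 M1; rewrite ltnNge (exit _ _ IN) /= in step1.
  by rewrite (ram_stepsS _ step1) (ram_stepsS _ (ram_step_jump _ _ Pl1)).
move=> Nk Ik; have lt_kN : k < N by lia.
have [lt_ab run] := body _ _ _ lt_kN Ik.
have [t1 [R2 [M2 [steps1 [le_t1 Ik1]]]]] := run _ _ Plc.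
have [|t2 [R3 [M3 [steps2 le_t2 IN]]]] := IHd k.+1 _ _ _ Ik1; first lia.
have step1 := step R1 M1; rewrite lt_ab in step1.
exists (t1 + t2.+1).+1, R3, M3; split=> //; last by rewrite big_ltn //; lia.
rewrite (ram_stepsS _ step1) (ram_stepsD _ steps1) -steps2; apply: ram_stepsS.
exact: ram_step_jump Pback.
Qed.

End Runs.

(** * Full Abelian periods and bad positions *)

Section Periods.

Variables (sigma : nat) (x : seq nat).

Local Notation n := (size x).

Definition cnt (a i : nat) : nat := count_mem a (take i x).

Lemma cnt_leq (a i : nat) : cnt a i <= i.
Proof.
apply: leq_trans (count_size _ _) _; rewrite size_take; case: ifP => // /negbT; lia.
Qed.

Lemma cntS (a i : nat) : i < n -> cnt a i.+1 = cnt a i + (nth 0 x i == a).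
Proof.
by move=> lt_i; rewrite /cnt (take_nth 0) // -cats1 count_cat /= addn0.
Qed.

Definition disproportional (a i : nat) : bool := cnt a i * n != i * cnt a n.

(** Restricting to letters below [A] describes the flags midway through the loop over the alphabet;
    [bad sigma] is the final state. *)
Definition bad (A i : nat) : bool := has (disproportional^~ i) (iota 0 A).

Lemma badS (A i : nat) : bad A.+1 i = bad A i || disproportional A i.
Proof. by rewrite /bad -addn1 iotaD has_cat /= orbF add0n. Qed.

(* Flag i just before p is sieved: only multipliers m all of whose primes are
   smaller than p have been propagated. *)
Definition reach (p i : nat) : bool :=
  has (fun m => [&& all (fun q => q < p) (primes m), i * m <= n & bad sigma (i * m)])
    (iota 1 n).

(* Marks p itself once p has been sieved, which is harmless as p is not
   visited again. *)
Definition composite (p j : nat) : bool := has (fun q => q < p) (primes j).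

(** The range [iota 1 n] loses no multiplier, since [m <= i * m <= n]. *)
Lemma reachP (p i : nat) :
  0 < i -> reflect (exists m, [/\ 0 < m, all (fun q => q < p) (primes m), i * m <= n
                               & bad sigma (i * m)]) (reach p i).
Proof.
move=> i_gt0; apply: (iffP hasP) => [[m]|[m [m_gt0 sm le_im bad_im]]].
  by rewrite mem_iota => /andP[m_gt0 _] /and3P[sm le_im bad_im]; exists m.
exists m; last by rewrite sm le_im.
rewrite mem_iota m_gt0 add1n ltnS; apply: leq_trans le_im; exact: leq_pmull.
Qed.

Lemma all_primes_ltS (p m : nat) : 0 < m ->
  all (fun q => q < p.+1) (primes m) ->
  all (fun q => q < p) (primes m) || prime p && (p %| m).
Proof.
move=> m_gt0 /allP sm; case: (boolP (p \in primes m)) => [|p_m].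
  by rewrite mem_primes => /and3P[-> _ ->]; rewrite orbT.
apply/orP; left; apply/allP => q q_m; have := sm _ q_m.
rewrite ltnS leq_eqVlt; case: eqP => // qp; by rewrite -qp q_m in p_m.
Qed.

Lemma reach_mono (p i : nat) : reach p i -> reach p.+1 i.
Proof.
apply: sub_has => m /and3P[/allP sm -> ->]; rewrite !andbT; apply/allP => q /sm.
exact: leqW.
Qed.

(** A multiplier either avoids [p] or is [p] times another admissible one. The flag at [i * p]
    occurs in its updated form, which is why the sieve goes downwards and can work in place. *)
Lemma reachS_prime (p i : nat) :
  prime p -> 0 < i -> reach p.+1 i = reach p i || reach p.+1 (i * p).
Proof.
move=> pr_p i_gt0; have p_gt0 := prime_gt0 pr_p.
have ip_gt0 : 0 < i * p by rewrite muln_gt0 i_gt0.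
apply/idP/idP.
  case/(reachP _ i_gt0) => m [m_gt0 sm le_im bad_im].
  case/orP: (all_primes_ltS m_gt0 sm) => [{}sm|/andP[_ /dvdnP[m' def_m]]].
    by apply/orP; left; apply/reachP => //; exists m.
  apply/orP; right; apply/reachP => //; exists m'.
  have m'_gt0 : 0 < m' by move: m_gt0; rewrite def_m muln_gt0 => /andP[].
  rewrite -mulnA (mulnC p) -def_m; split=> //.
  apply/allP => q q_m'; apply: (allP sm).
  by rewrite def_m primesM // q_m'.
case/orP => [/reach_mono //|/(reachP _ ip_gt0)[m [m_gt0 sm le_im bad_im]]].
apply/reachP => //; exists (p * m); rewrite mulnA muln_gt0 p_gt0; split=> //.
apply/allP => q; rewrite primesM // primes_prime // mem_seq1.
by case/orP => [/eqP->|] //; apply: (allP sm).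
Qed.

Lemma reachS_nonprime (p i : nat) :
  ~~ prime p -> 0 < i -> reach p.+1 i = reach p i.
Proof.
move=> npr_p i_gt0; apply/idP/idP => [|/reach_mono //].
case/(reachP _ i_gt0) => m [m_gt0 sm le_im bad_im].
have := all_primes_ltS m_gt0 sm; rewrite (negbTE npr_p) orbF => {}sm.
by apply/reachP => //; exists m.
Qed.

(** This lets the loop for [p] start at [n %/ p]: for larger [i] the recurrence changes nothing. *)
Lemma reach_out_of_range (p i : nat) : n < i -> reach p i = false.
Proof.
move=> lt_ni; have i_gt0 : 0 < i by lia.
apply/(reachP _ i_gt0) => -[m [m_gt0 _ le_im _]]; nia.
Qed.

(** The only multiplier without primes is 1, so the sieve starts from the flags of the bad
    positions. *)
Lemma reach2 (i : nat) : 0 < i <= n -> reach 2 i = bad sigma i.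
Proof.
case/andP=> i_gt0 le_in; apply/(reachP _ i_gt0)/idP => [[m [m_gt0 sm _]]|bad_i].
  have -> : m = 1.
    case: m m_gt0 sm => [|[|m]] // _ /allP sm.
    have := sm (pdiv m.+2); rewrite mem_primes pdiv_prime // pdiv_dvd => /(_ isT).
    by rewrite ltnNge prime_gt1 // pdiv_prime.
  by rewrite muln1.
by exists 1; rewrite muln1.
Qed.

Lemma compositeS_prime (p j : nat) :
  prime p -> 0 < j -> composite p.+1 j = composite p j || (p %| j).
Proof.
move=> pr_p j_gt0; apply/hasP/orP => [[q q_j]|[/hasP[q q_j lt_q]|p_j]].
- rewrite ltnS leq_eqVlt => /orP[/eqP<-|lt_q].
    by right; move: q_j; rewrite mem_primes => /and3P[].
  by left; apply/hasP; exists q.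
- by exists q => //; apply: leqW.
- by exists p => //; rewrite mem_primes pr_p j_gt0.
Qed.

Lemma compositeS_nonprime (p j : nat) :
  ~~ prime p -> composite p.+1 j = composite p j.
Proof.
move=> npr_p; apply: eq_in_has => q; rewrite mem_primes => /and3P[pr_q _ _].
rewrite ltnS leq_eqVlt; case: eqP => // qp; by rewrite -qp pr_q in npr_p.
Qed.

Lemma composite2 (j : nat) : composite 2 j = false.
Proof.
apply/hasP => -[q]; rewrite mem_primes => /and3P[/prime_gt1 q_gt1 _ _].
by rewrite ltnNge q_gt1.
Qed.

(** The least prime divisor of a nonprime [p] is below [p], so the sieve flag decides primality by
    the time [p] is visited. *)
Lemma composite_self (p : nat) : 1 < p -> composite p p = ~~ prime p.
Proof.
move=> p_gt1; apply/hasP/idP => [[q]|npr_p].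
  rewrite mem_primes => /and3P[pr_q _ q_p] lt_q; apply/primePn; right.
  by exists q => //; rewrite prime_gt1.
exists (pdiv p); first by rewrite mem_primes pdiv_prime // pdiv_dvd ltnW.
have := pdiv_leq (ltnW p_gt1); rewrite leq_eqVlt => /orP[/eqP pp|//].
by rewrite -pp pdiv_prime in npr_p.
Qed.

Definition periods : seq nat := [seq d <- iota 1 n | (d %| n) && ~~ reach n.+1 d].

Lemma mem_periods (p : nat) :
  (p \in periods) <->
  [/\ 0 < p, 0 < n, p %| n &
      forall a m, a < sigma -> p * m <= n -> cnt a (p * m) * n = p * m * cnt a n].
Proof.
rewrite mem_filter mem_iota add1n ltnS.
split=> [/andP[/andP[p_n nreach] /andP[p_gt0 le_pn]]|[p_gt0 n_gt0 p_n good]].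
  split=> // [|a m lt_a le_pm]; first lia.
  have [->|m_gt0] := posnP m; first by rewrite muln0 /cnt take0.
  apply/eqP; apply: contraNT nreach => dis; apply/reachP => //; exists m; split=> //.
    apply/allP => q; rewrite mem_primes => /and3P[_ _ /(dvdn_leq m_gt0) le_q].
    by rewrite ltnS (leq_trans le_q) // (leq_trans _ le_pm) // leq_pmull.
  by apply/hasP; exists a; rewrite // mem_iota.
rewrite p_n p_gt0 dvdn_leq // !andbT /=; apply/(reachP _ p_gt0) => -[m [m_gt0 _ le_pm]].
case/hasP=> a; rewrite mem_iota add0n => lt_a.
by rewrite /disproportional good ?eqxx.
Qed.

End Periods.

(** * Proportional prefixes and factorisations into blocks *)

Lemma count_flatten_uniform (T : eqType) (a : pred T) (c : nat) (s : seq (seq T)) :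
  (forall u, u \in s -> count a u = c) -> count a (flatten s) = size s * c.
Proof.
elim: s => //= u s IHs H; rewrite count_cat mulSn H ?mem_head // IHs //.
by move=> v vs; apply: H; rewrite inE vs orbT.
Qed.

Lemma cnt_val (sigma : nat) (w : seq 'I_sigma) (a : 'I_sigma) (i : nat) :
  cnt [seq nat_of_ord b | b <- w] a i = count_mem a (take i w).
Proof. by rewrite /cnt -map_take count_map; apply: eq_count => b. Qed.

Lemma periods_full_abelian_period (sigma : nat) (w : seq 'I_sigma) (p : nat) :
  p \in periods sigma [seq nat_of_ord a | a <- w] <-> full_abelian_period w p.
Proof.
split=> [p_in|[p_gt0 [us [def_w us_gt0 size_us parikh_us]]]].
  have [p_gt0] := (mem_periods _ _ _).1 p_in; rewrite size_map => n_gt0 p_n good.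
  split=> //.
  have le_pn : p <= size w by apply: dvdn_leq.
  have sumnE k : sumn (nseq k p) = k * p by rewrite sumn_nseq mulnC.
  set us := reshape (nseq (size w %/ p) p) w.
  have size_us : size us = size w %/ p by rewrite size_reshape size_nseq.
  have us_nth u : u \in us ->
      exists2 i, i.+1 * p <= size w & u = take p (drop (i * p) w).
    case/(nthP [::]) => i; rewrite size_us => lt_i <-; exists i.
      by rewrite -leq_divRL.
    by rewrite nth_reshape nth_nseq lt_i take_nseq ?sumnE // ltnW.
  exists us; split.
  - by rewrite reshapeKr // sumnE divnK.
  - by rewrite size_us divn_gt0.
  - move=> u /us_nth[i]; rewrite mulSn => le_i ->; rewrite size_takel // size_drop.
    by rewrite leq_subRL ?(leq_trans (leq_addl _ _) le_i) // addnC.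
  (* A block is the difference of two consecutive proportional prefixes, hence proportional itself;
     cancelling [size w] then equates the Parikh vectors. *)
  have cntu (a : 'I_sigma) u : u \in us -> count_mem a u * size w = p * count_mem a w.
    case/us_nth => i le_i ->.
    have prop k : k * p <= size w ->
        count_mem a (take (k * p) w) * size w = k * p * count_mem a w.
      by have := good a k (ltn_ord a); rewrite (mulnC p) !cnt_val take_size.
    have le_ip : i * p <= size w by apply: leq_trans le_i; rewrite leq_mul.
    have := prop _ le_i; rewrite mulSn addnC takeD count_cat !mulnDl (prop _ le_ip).
    by move/addnI.
  move=> u v u_us v_us; apply/ffunP => a; rewrite !ffunE; apply/eqP.
  by rewrite -(eqn_pmul2r n_gt0) !cntu.
have size_w : size w = size us * p.
  rewrite def_w -count_predT; apply: count_flatten_uniform => u /size_us <-.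
  by rewrite count_predT.
apply/mem_periods; rewrite size_map; split=> //.
- by rewrite size_w muln_gt0 us_gt0.
- by rewrite size_w dvdn_mull.
move=> a m lt_a; rewrite size_w mulnC leq_pmul2r // => le_m.
case: us us_gt0 => // u0 us' _ in def_w size_us parikh_us size_w le_m *.
set us := u0 :: us' in def_w size_us parikh_us size_w le_m *.
rewrite -[a]/(nat_of_ord (Ordinal lt_a)) !cnt_val; set b := Ordinal lt_a.
have count_us u : u \in us -> count_mem b u = count_mem b u0.
  by move=> u_us; have /ffunP/(_ b) := parikh_us _ _ u_us (mem_head u0 us'); rewrite !ffunE.
(* The prefix of length [m * p] consists of the first [m] blocks, each with as many letters [b] as
   [u0]. *)
have take_w : take (m * p) w = flatten (take m us).
  have size_t : size (flatten (take m us)) = m * p.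
    rewrite -count_predT (@count_flatten_uniform _ _ p) ?size_takel // => u /mem_take.
    by move/size_us; rewrite count_predT.
  by rewrite def_w -{1}(cat_take_drop m us) flatten_cat -size_t take_size_cat.
rewrite take_w -size_w take_size size_w (@count_flatten_uniform _ _ (count_mem b u0)).
  rewrite size_takel // def_w (@count_flatten_uniform _ _ (count_mem b u0)) //.
  by rewrite [size us * p]mulnC mulnACA [size us * _]mulnC.
by move=> u /mem_take/count_us.
Qed.

(** * The algorithm *)

Local Notation "c1 ;; c2" := (Seq c1 c2) (at level 100, right associativity).

(* Registers: 0 is n, 1 is 0, 2 is 1, 3 is the size of the alphabet and later
   n + 1, 4 the letter, prime or divisor under consideration, 5 its number of
   occurrences in the word and 10 that in the current prefix (for a letter),
   6 the inner loop counter, 11 the length of the output; 7, 8, 9 are scratch. *)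
Definition count_step (r : nat) : cmd :=
  (Do (Read 7 6);;
   Do (Op Defs.Sub 8 7 4);; Do (Op Defs.Sub 9 4 7);; Do (Op Add 8 8 9);;
   IfLt 8 2 (Do (Op Add r r 2));;
   Do (Op Add 6 6 2)).

(** The two truncated differences add up to the absolute difference, which vanishes exactly at
    equality; [count_step] compares letters in the same way. Register 6 has already been advanced,
    so it holds the prefix length. *)
Definition mark_step : cmd :=
  (Do (Op Mul 7 10 0);; Do (Op Mul 8 6 5);;
   Do (Op Defs.Sub 9 7 8);; Do (Op Defs.Sub 8 8 7);; Do (Op Add 8 8 9);;
   IfLt 1 8 (Do (Op Add 9 0 6);; Do (Write 9 2))).

Definition letter_step : cmd :=
  (Do (Const 5 0);; Do (Const 6 0);; WhileLt 6 0 (count_step 5);;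
   Do (Const 10 0);; Do (Const 6 0);; WhileLt 6 0 (count_step 10;; mark_step);;
   Do (Op Add 4 4 2)).

Definition mark_phase (sigma : nat) : cmd :=
  (Do (Const 2 1);; Do (Const 3 sigma);; WhileLt 4 3 letter_step).

(** For [k] in register 6 and [p] in register 4, cell [n + k] inherits the flag in cell [n + k * p],
    and the sieve flag in cell [2 * n + k * p] is set. *)
Definition sieve_step : cmd :=
  (Do (Op Mul 7 6 4);; Do (Op Add 7 7 0);; Do (Read 8 7);;
   IfLt 1 8 (Do (Op Add 9 0 6);; Do (Write 9 2));;
   Do (Op Add 7 7 0);; Do (Write 7 2);; Do (Op Defs.Sub 6 6 2)).

Definition prime_step : cmd :=
  (Do (Op Add 7 0 0);; Do (Op Add 7 7 4);; Do (Read 8 7);;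
   IfLt 8 2 (Do (Op Div 6 0 4);; WhileLt 1 6 sieve_step);;
   Do (Op Add 4 4 2)).

Definition sieve_phase : cmd :=
  (Do (Op Add 3 0 2);; Do (Const 4 2);; WhileLt 4 3 prime_step).

(** The remainder of [n] modulo [d] plus the flag of [d] is 0 exactly when [d] is a period, so one
    test suffices. *)
Definition output_step : cmd :=
  (Do (Op Div 7 0 4);; Do (Op Mul 7 7 4);; Do (Op Defs.Sub 7 0 7);;
   Do (Op Add 8 0 4);; Do (Read 8 8);; Do (Op Add 7 7 8);;
   IfLt 7 2 (Do (Write 11 4);; Do (Op Add 11 11 2));;
   Do (Op Add 4 4 2)).

Definition output_phase : cmd :=
  (Do (Const 4 1);; WhileLt 4 3 output_step;; Do (Op Add 0 11 1)).

(** A frame condition: [s] lists the registers that may change. *)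
Definition agree (s : seq nat) (R R' : nat -> nat) : Prop :=
  forall j, j \notin s -> R' j = R j.

Lemma agree_refl s R : agree s R R.
Proof. by []. Qed.

Lemma agree_upd s R R' r v : r \in s -> agree s R R' -> agree s R (upd R' r v).
Proof. by move=> rs H j js; rewrite /upd ifF ?H //; apply: contraNF js => /eqP->. Qed.

Lemma agree_trans s R1 R2 R3 : agree s R1 R2 -> agree s R2 R3 -> agree s R1 R3.
Proof. by move=> H12 H23 j js; rewrite H23 // H12. Qed.

Lemma agree_sub s s' R R' : {subset s <= s'} -> agree s R R' -> agree s' R R'.
Proof. by move=> ss' H j js'; apply: H; apply: contra js'; apply: ss'. Qed.

Lemma updE f i v j : upd f i v j = if j == i then v else f j.
Proof. by []. Qed.

Ltac solve_agree := repeat (apply: agree_upd; [by rewrite !inE | ]); exact: agree_refl.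

Ltac step :=
  first [apply: runs_op | apply: runs_const | apply: runs_write | apply: runs_read];
  rewrite /= ?updE /=.

Ltac seq_step := apply: runs_seq; step.

(** * Correctness and running time of the phases *)

Section Machine.

Variables (sigma bits : nat) (x : seq nat).
Hypothesis letter_lt : all (fun a => a < sigma) x.
Local Notation n := (size x).
Local Notation cells := (3 * n + 1).
(** Room for the cross products, which are at most [n * n], for addresses up to [3 * n], and for the
    constants. *)
Hypothesis word_size : n * n + 3 * n + sigma + 3 <= 2 ^ bits.

Local Notation runs := (runs cells bits).

Local Notation cnt := (cnt x).
Local Notation disproportional := (disproportional x).
Local Notation bad := (bad x).
Local Notation reach := (reach sigma x).
Local Notation periods := (periods sigma x).

Definition input_at (M : nat -> nat) : Prop := forall j, j < n -> M j = nth 0 x j.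

(** Table [b] concerns bad positions and table [c] the sieve; booleans are stored as 0 or 1. *)
Definition flags_at (M : nat -> nat) (b c : nat -> bool) : Prop :=
  forall j, 0 < j <= n -> M (n + j) = b j /\ M (n + n + j) = c j.

Lemma flags_at_ext M b c b' c' :
  (forall j, 0 < j <= n -> b j = b' j /\ c j = c' j) ->
  flags_at M b c -> flags_at M b' c'.
Proof. by move=> E H j jn; have [-> ->] := H _ jn; have [-> ->] := E _ jn. Qed.

Lemma flags_at_left M b c k : 0 < k <= n ->
  flags_at M b c -> flags_at (upd M (n + k) 1) (fun j => (j == k) || b j) c.
Proof.
move=> kn H j jn; have [Hb Hc] := H _ jn; rewrite /upd Hc eqn_add2l.
rewrite (_ : (n + n + j == n + k) = false); last lia.
by case: eqP.
Qed.

Lemma flags_at_right M b c k : 0 < k <= n ->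
  flags_at M b c -> flags_at (upd M (n + n + k) 1) b (fun j => (j == k) || c j).
Proof.
move=> kn H j jn; have [Hb Hc] := H _ jn; rewrite /upd Hb eqn_add2l.
rewrite (_ : (n + j == n + n + k) = false); last lia.
by case: eqP.
Qed.

Lemma input_at_upd M k v : n <= k -> input_at M -> input_at (upd M k v).
Proof. by move=> nk H j jn; rewrite /upd ifF ?H //; lia. Qed.

Lemma count_step_runs r R M a i :
  r \in [:: 5; 10] -> i < n -> a < sigma -> input_at M ->
  R 0 = n -> R 2 = 1 -> R 4 = a -> R 6 = i -> R r <= i ->
  runs (count_step r) R M (fun t R' M' =>
    [/\ t <= 7, R' r = R r + (nth 0 x i == a), R' 6 = i.+1,
        agree [:: r; 6; 7; 8; 9] R R' & M' = M]).
Proof.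
move=> r_in lt_i lt_a inM R0 R2 R4 R6 le_r.
have lt_x : nth 0 x i < sigma by apply: (allP letter_lt); rewrite mem_nth.
seq_step; rewrite ?R6 ?inM //; try lia.
do 3 (seq_step; rewrite ?R4; first lia).
have d0 : (nth 0 x i - a + (a - nth 0 x i) < 1) = (nth 0 x i == a) by lia.
move: r_in le_r; rewrite !inE => /orP[]/eqP-> le_r; apply: runs_seq.
all: apply: runs_if; rewrite /= !updE /= R2 ?[1 <= _]leqNgt d0 => d0';
 rewrite ?d0' ?(negbTE d0').
all: repeat (step; rewrite ?R2; first lia).
all: rewrite ?R2 ?R6.
all: by split; rewrite ?updE //= ?addn1 ?addn0 //; solve_agree.
Qed.

Lemma mark_step_runs R M a i b c :
  0 < i <= n -> R 0 = n -> R 1 = 0 -> R 2 = 1 -> R 5 = cnt a n -> R 6 = i ->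
  R 10 = cnt a i -> input_at M -> flags_at M b c ->
  runs mark_step R M (fun t R' M' =>
    [/\ t <= 8, agree [:: 7; 8; 9] R R', input_at M' &
        flags_at M' (fun j => (j == i) && disproportional a i || b j) c]).
Proof.
move=> i_n R0 R1 R2 R5 R6 R10 inM flM.
have le1 : cnt a i * n <= n * n by apply: leq_mul => //; have := cnt_leq x a i; lia.
have le2 : i * cnt a n <= n * n by apply: leq_mul; [lia | apply: cnt_leq].
rewrite /mark_step.
do 5 (seq_step; rewrite ?R0 ?R5 ?R6 ?R10; first lia).
have d0 : (0 < i * cnt a n - cnt a i * n + (cnt a i * n - i * cnt a n)) =
    disproportional a i by rewrite /disproportional; lia.
apply: runs_if; rewrite /= !updE /= R1 ?[_ <= 0]leqNgt d0 => d0'.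
  seq_step; rewrite R0 R6; first lia.
  step; rewrite ?R2; first lia.
  split=> //; first solve_agree; first by apply: input_at_upd => //; lia.
  apply: flags_at_ext (flags_at_left i_n flM) => j _.
  by rewrite d0' andbT.
split=> //; first solve_agree.
by apply: flags_at_ext flM => j _; rewrite (negbTE d0') andbF.
Qed.

Lemma letter_step_runs R M a c :
  a < sigma -> R 0 = n -> R 1 = 0 -> R 2 = 1 -> R 4 = a ->
  input_at M -> flags_at M (bad a) c ->
  runs letter_step R M (fun t R' M' =>
    [/\ t <= 26 * n + 9, R' 4 = a.+1, agree [:: 4; 5; 6; 7; 8; 9; 10] R R',
        input_at M' & flags_at M' (bad a.+1) c]).
Proof.
move=> lt_a R0 R1 R2 R4 inM flM; rewrite /letter_step.
do 2 (seq_step; first lia).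
set Ra := upd _ 6 0.
have agRa : agree [:: 5; 6; 7; 8; 9] R Ra by solve_agree.
apply: runs_seq; apply: runs_weaken.
  apply: (@runs_while _ _ _ _ _ n (fun=> 7) (fun k R' M' =>
    [/\ R' 5 = cnt a k, R' 6 = k, agree [:: 5; 6; 7; 8; 9] R R' & M' = M])).
  - move=> k R' M' lt_k [R5 R6 ag ->]; rewrite R6 (ag 0) // R0; split=> //.
    apply: runs_weaken.
      apply: (@count_step_runs _ _ _ a k) => //.
      + by rewrite (ag 0).
      + by rewrite (ag 2).
      + by rewrite (ag 4).
      + by rewrite R5 cnt_leq.
    move=> t R'' M'' [le_t R5' R6' ag' ->]; split=> //; split=> //.
      by rewrite R5' R5 cntS.
    exact: agree_trans ag ag'.
  - by move=> R' M' [_ -> ag _]; rewrite (ag 0) ?R0.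
  - by rewrite /cnt take0.
move=> t1 R1' M1 [le_t1 [R5 _ ag1 ->]].
do 2 (seq_step; first lia).
set Rb := upd _ 6 0.
have agRb : agree [:: 6; 7; 8; 9; 10] R1' Rb by solve_agree.
apply: runs_seq; apply: runs_weaken.
  (* After [k] rounds the flags up to position [k] take letter [a] into account, the later ones do
     not yet. *)
  apply: (@runs_while _ _ _ _ _ n (fun=> 15) (fun k R' M' =>
    [/\ R' 10 = cnt a k, R' 6 = k, agree [:: 6; 7; 8; 9; 10] R1' R', input_at M' &
        flags_at M' (fun j => bad (if j <= k then a.+1 else a) j) c])).
  - move=> k R' M' lt_k [R10 R6 ag inM' flM'].
    rewrite R6 (ag 0) // (ag1 0) // R0; split=> //.
    apply: runs_seq; apply: runs_weaken.
      apply: (@count_step_runs _ _ _ a k) => //.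
      + by rewrite (ag 0) // (ag1 0).
      + by rewrite (ag 2) // (ag1 2).
      + by rewrite (ag 4) // (ag1 4).
      + by rewrite R10 cnt_leq.
    move=> t R'' M'' [le_t R10' R6' ag' ->].
    apply: runs_weaken.
      apply: (@mark_step_runs _ _ a k.+1) inM' flM' => //.
      + by rewrite (ag' 0) // (ag 0) // (ag1 0).
      + by rewrite (ag' 1) // (ag 1) // (ag1 1).
      + by rewrite (ag' 2) // (ag 2) // (ag1 2).
      + by rewrite (ag' 5) // (ag 5).
      + by rewrite R10' R10 cntS.
    move=> t' R3 M3 [le_t' ag3 inM3 flM3]; split; first lia.
    split=> //.
    + by rewrite (ag3 10) // R10' R10 cntS.
    + by rewrite (ag3 6).
    + apply: agree_trans ag _; apply: (@agree_trans _ _ R'').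
        by apply: agree_sub ag' => j; rewrite !inE; lia.
      by apply: agree_sub ag3 => j; rewrite !inE; lia.
    + apply: flags_at_ext flM3 => j _; split=> //.
      rewrite [j <= k.+1]leq_eqVlt ltnS; case: eqP => [->|_] //=.
      by rewrite ltnn badS orbC.
  - by move=> R' M' [_ -> ag _ _]; rewrite (ag 0) // (ag1 0) ?R0.
  - split=> //; first by rewrite /cnt take0.
    by apply: flags_at_ext flM => j /andP[j_gt0 _]; rewrite leqNgt j_gt0.
move=> t2 R2' M2 [le_t2 [_ _ ag2 inM2 flM2]].
have R24 : R2' 4 = a by rewrite (ag2 4) // (ag1 4).
have R22 : R2' 2 = 1 by rewrite (ag2 2) // (ag1 2).
step; rewrite R24 R22; first lia.
split=> //.
- by move: le_t1 le_t2; rewrite !sum_nat_const !card_ord; lia.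
- by rewrite addn1.
- apply: agree_upd => //; apply: (@agree_trans _ _ R1').
    by apply: agree_sub ag1 => j; rewrite !inE; lia.
  by apply: agree_sub ag2 => j; rewrite !inE; lia.
- by apply: flags_at_ext flM2 => j /andP[_ ->].
Qed.

Lemma mark_phase_runs R M c :
  R 0 = n -> R 1 = 0 -> R 4 = 0 -> input_at M -> flags_at M xpred0 c ->
  runs (mark_phase sigma) R M (fun t R' M' =>
    [/\ t <= sigma * (26 * n + 11) + 4, R' 2 = 1,
        agree [:: 2; 3; 4; 5; 6; 7; 8; 9; 10] R R' & flags_at M' (bad sigma) c]).
Proof.
move=> R0 R1 R4 inM flM; rewrite /mark_phase.
seq_step; first lia; seq_step; first lia.
apply: runs_weaken.
  apply: (@runs_while _ _ _ _ _ sigma (fun=> 26 * n + 9) (fun a R' M' =>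
    [/\ R' 2 = 1, R' 3 = sigma, R' 4 = a,
        agree [:: 2; 3; 4; 5; 6; 7; 8; 9; 10] R R' &
        input_at M' /\ flags_at M' (bad a) c])).
  - move=> a R' M' lt_a [R2 R3 R4' ag [inM' flM']]; rewrite R4' R3; split=> //.
    apply: runs_weaken.
      by apply: letter_step_runs inM' flM'; rewrite // ?(ag 0) ?(ag 1).
    move=> t R'' M'' [le_t R4'' ag' inM'' flM'']; split=> //; split=> //.
    + by rewrite (ag' 2).
    + by rewrite (ag' 3).
    + apply: agree_trans ag _.
      by apply: agree_sub ag' => j; rewrite !inE; lia.
  - by move=> R' M' [_ -> -> _ _].
  - by split=> //; solve_agree.
move=> t R' M' [le_t [R2 _ _ ag [_ flM']]]; split=> //.
by move: le_t; rewrite sum_nat_const card_ord; lia.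
Qed.

Lemma sieve_step_runs R M p k b c :
  0 < k -> 0 < p -> k * p <= n -> R 0 = n -> R 1 = 0 -> R 2 = 1 -> R 4 = p -> R 6 = k ->
  flags_at M b c ->
  runs sieve_step R M (fun t R' M' =>
    [/\ t <= 9, R' 6 = k.-1, agree [:: 6; 7; 8; 9] R R' &
        flags_at M' (fun j => (j == k) && b (k * p) || b j)
                    (fun j => (j == k * p) || c j)]).
Proof.
move=> k_gt0 p_gt0 le_kp R0 R1 R2 R4 R6 flM; rewrite /sieve_step.
have kp_n : 0 < k * p <= n by rewrite muln_gt0 k_gt0 p_gt0.
have k_n : 0 < k <= n by rewrite k_gt0 (leq_trans _ le_kp) // leq_pmulr.
have Mkp : M (k * p + n) = b (k * p) by rewrite addnC; case: (flM _ kp_n).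
do 2 (seq_step; rewrite ?R0 ?R4 ?R6; first lia).
seq_step; rewrite ?Mkp; [lia | by case: (b _); lia |].
apply: runs_seq; apply: runs_if; rewrite /= !updE /= R1 ?[_ <= 0]leqNgt lt0b => bkp.
  seq_step; rewrite ?R0 ?R6; first lia.
  step; rewrite ?R2; first lia.
  seq_step; rewrite ?R0; first lia.
  seq_step; rewrite ?R2; first lia.
  step; rewrite ?R2 ?R6; first lia.
  split; [by [] | exact: subn1 | solve_agree |].
  rewrite -addnA [k * p + _]addnC.
  apply: flags_at_ext (flags_at_right kp_n (flags_at_left k_n flM)) => j _.
  by rewrite bkp andbT.
seq_step; rewrite ?R0; first lia.
seq_step; rewrite ?R2; first lia.
step; rewrite ?R2 ?R6; first lia.
split; [by [] | exact: subn1 | solve_agree |].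
rewrite -addnA [k * p + _]addnC.
apply: flags_at_ext (flags_at_right kp_n flM) => j _.
by rewrite (negbTE bkp) andbF.
Qed.

Lemma prime_step_runs R M p :
  1 < p <= n -> R 0 = n -> R 1 = 0 -> R 2 = 1 -> R 4 = p ->
  flags_at M (reach p) (composite p) ->
  runs prime_step R M (fun t R' M' =>
    [/\ t <= 8 + (if prime p then 11 * (n %/ p) else 0), R' 4 = p.+1,
        agree [:: 4; 6; 7; 8; 9] R R' &
        flags_at M' (reach p.+1) (composite p.+1)]).
Proof.
move=> p_n R0 R1 R2 R4 flM; rewrite /prime_step.
have p_gt1 : 1 < p by case/andP: p_n.
have p_gt0 : 0 < p by lia.
have Mp : M (n + n + p) = ~~ prime p.
  by rewrite -composite_self //; apply: (flM p _).2; lia.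
do 2 (seq_step; rewrite ?R0 ?R4; first lia).
seq_step; rewrite ?Mp; [lia | by case: (prime p); lia |].
apply: runs_seq; apply: runs_if; rewrite /= !updE /= R2.
  rewrite ltnS leqn0 eqb0 negbK => pr_p; rewrite pr_p.
  have le_np : n %/ p * p <= n by apply: leq_divM.
  have le_q : n %/ p <= n by apply: leq_div.
  seq_step; rewrite ?R0 ?R4; first lia.
  set Ra := upd _ 6 _.
  have agRa : agree [:: 4; 6; 7; 8; 9] R Ra by solve_agree.
  apply: runs_weaken.
    (* After [k] rounds exactly the indices above [n %/ p - k] have their flags for [p.+1], and the
       multiples of [p] with quotient above that bound are marked. *)
    apply: (@runs_while _ _ _ _ _ (n %/ p) (fun=> 9) (fun k R' M' =>
      [/\ R' 4 = p, R' 6 = n %/ p - k, agree [:: 4; 6; 7; 8; 9] R R' &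
          flags_at M' (fun j => reach (if n %/ p - k < j then p.+1 else p) j)
            (fun j => composite p j || (p %| j) && (n %/ p - k < j %/ p))])).
    - move=> k R' M' lt_k [R4' R6 ag flM']; rewrite R6 (ag 1) // R1 subn_gt0.
      split=> //.
      set q := n %/ p - k in R6 flM' *.
      have q_gt0 : 0 < q by rewrite /q; lia.
      have le_qp : q * p <= n.
        by apply: leq_trans le_np; rewrite leq_mul2r leq_subr orbT.
      apply: runs_weaken.
        apply: (@sieve_step_runs _ _ p q) flM' => //.
        + by rewrite (ag 0).
        + by rewrite (ag 1).
        + by rewrite (ag 2).
      move=> t R'' M'' [le_t R6' ag' flM'']; split=> //; split=> //.
      + by rewrite (ag' 4).
      + by rewrite R6' /q; lia.
      + apply: agree_trans ag _.
        by apply: agree_sub ag' => j; rewrite !inE; lia.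
      have -> : n %/ p - k.+1 = q.-1 by rewrite /q; lia.
      apply: flags_at_ext flM'' => j j_n; rewrite !prednK //; split.
        rewrite [q <= j]leq_eqVlt (eq_sym q); case: eqP => [->|_] //=.
        (* As [q < q * p], the flag read at [q * p] is already the updated one. *)
        by rewrite ltnn ltn_Pmulr // (reachS_prime sigma x pr_p q_gt0) orbC.
      rewrite orbCA; congr (_ || _).
      rewrite [q <= _]leq_eqVlt andb_orr; congr (_ || _).
      apply/eqP/andP => [->|[p_j /eqP->]]; last by rewrite divnK.
      by rewrite dvdn_mull // mulnK.
    - by move=> R' M' [_ -> ag _]; rewrite (ag 1) // R1 subnn.
    - split=> //; first by rewrite subn0.
      apply: flags_at_ext flM => j j_n; rewrite subn0; split.
        case: ltnP => // lt_j; rewrite reachS_prime //; last by case/andP: j_n.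
        by rewrite (@reach_out_of_range sigma x _ (j * p)) ?orbF // -ltn_divLR.
      rewrite [_ && _](_ : _ = false) ?orbF //; apply/negbTE.
      by rewrite negb_and -leqNgt leq_div2r ?orbT //; case/andP: j_n.
  move=> t R' M' [le_t [R4' _ ag flM']].
  have R2' : R' 2 = 1 by rewrite (ag 2).
  step; rewrite R4' R2'; first lia.
  split; [| by rewrite addn1 | by apply: agree_upd |].
    by move: le_t; rewrite sum_nat_const card_ord; lia.
  apply: flags_at_ext flM' => j j_n; have j_gt0 : 0 < j by case/andP: j_n.
  rewrite subnn j_gt0 compositeS_prime //; split=> //; congr (_ || _).
  case: (boolP (p %| j)) => //= p_j; by rewrite divn_gt0 // dvdn_leq.
case: (boolP (prime p)) => //= npr_p _.
step; rewrite R4 R2; first lia.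
split; [by [] | by rewrite addn1 | solve_agree |].
apply: flags_at_ext flM => j /andP[j_gt0 _].
by rewrite reachS_nonprime // compositeS_nonprime.
Qed.

Lemma sieve_phase_runs R M :
  R 0 = n -> R 1 = 0 -> R 2 = 1 -> flags_at M (bad sigma) xpred0 ->
  runs sieve_phase R M (fun t R' M' =>
    [/\ t <= 10 * n + 11 * (\sum_(2 <= p < n.+1 | prime p) n %/ p) + 4, R' 3 = n.+1,
        agree [:: 3; 4; 6; 7; 8; 9] R R' & flags_at M' (reach n.+1) (composite n.+1)]).
Proof.
move=> R0 R1 R2 flM; rewrite /sieve_phase.
seq_step; rewrite R0 R2; first lia.
seq_step; first lia.
(* Round [k] treats [k.+2], so there are [n.-1] rounds; for [n = 0] the test of 2 against [n.+1]
   fails at once. *)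
set T := fun k => 8 + (if prime k.+2 then 11 * (n %/ k.+2) else 0).
apply: runs_weaken.
  apply: (@runs_while _ _ _ _ _ n.-1 T (fun k R' M' =>
    [/\ R' 3 = n.+1, R' 4 = k.+2, agree [:: 3; 4; 6; 7; 8; 9] R R' &
        flags_at M' (reach k.+2) (composite k.+2)])).
  - move=> k R' M' lt_k [R3 R4 ag flM']; rewrite R3 R4; split; first lia.
    apply: runs_weaken.
      apply: (@prime_step_runs _ _ k.+2) flM' => //; first lia.
      + by rewrite (ag 0).
      + by rewrite (ag 1).
      + by rewrite (ag 2).
    move=> t R'' M'' [le_t R4' ag' flM'']; split=> //; split=> //.
      by rewrite (ag' 3).
    apply: agree_trans ag _.
    by apply: agree_sub ag' => j; rewrite !inE; lia.
  - by move=> R' M' [-> -> _ _]; lia.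
  - split=> //; first by rewrite updE /= addn1.
      solve_agree.
    by apply: flags_at_ext flM => j j_n; rewrite reach2 // composite2.
move=> t R' M' [le_t [R3 _ ag flM']]; split=> //; last first.
  apply: flags_at_ext flM' => j /andP[j_gt0 le_jn].
  by have -> : n.-1.+2 = n.+1 by lia.
suff : \sum_(k < n.-1) (T k).+2 <= 10 * n + 11 * (\sum_(2 <= p < n.+1 | prime p) n %/ p).
  by lia.
rewrite (_ : \sum_(k < n.-1) (T k).+2 =
   \sum_(2 <= p < n.+1) (10 + (if prime p then 11 * (n %/ p) else 0))); last first.
  by rewrite -(big_mkord xpredT (fun k => (T k).+2)) (big_addn 0 n.+1 2) -subn1;
     apply: eq_bigr => k _; rewrite addn2.
rewrite big_split /= sum_nat_const_nat big_distrr /= [in leqRHS]big_mkcond leq_add2r; lia.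
Qed.

Lemma flags_at_low M b c k v : k < n -> flags_at M b c -> flags_at (upd M k v) b c.
Proof.
move=> lt_k H j jn; have [Hb Hc] := H _ jn.
by rewrite /upd !ifF ?Hb ?Hc //; lia.
Qed.

Lemma output_phase_runs R M c :
  R 0 = n -> R 1 = 0 -> R 2 = 1 -> R 3 = n.+1 -> R 11 = 0 ->
  flags_at M (reach n.+1) c ->
  runs output_phase R M (fun t R' M' =>
    [/\ t <= 13 * n + 4, R' 0 <= n & mkseq M' (R' 0) = periods]).
Proof.
move=> R0 R1 R2 R3 R11 flM; rewrite /output_phase.
seq_step; first lia.
pose ok d := (d %| n) && ~~ reach n.+1 d.
pose out k := [seq d <- iota 1 k | ok d].
apply: runs_seq; apply: runs_weaken.
  apply: (@runs_while _ _ _ _ _ n (fun=> 11) (fun k R' M' =>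
    [/\ R' 4 = k.+1, R' 11 = size (out k),
        mkseq M' (R' 11) = out k,
        agree [:: 4; 7; 8; 11] R R' & flags_at M' (reach n.+1) c])).
  - move=> k R' M' lt_k [R4 R11' outM ag flM'].
    rewrite R4 (ag 3) // R3; split=> //.
    have R0' : R' 0 = n by rewrite (ag 0).
    have R2' : R' 2 = 1 by rewrite (ag 2).
    (* The output overwrites the word: at most [k] periods have been found so far, so the next one
       goes below cell [n] and spares the flags. *)
    have le_out : R' 11 <= k by rewrite R11' size_filter -{2}(size_iota 1 k) count_size.
    have Mk : M' (n + k.+1) = reach n.+1 k.+1 by apply: (flM' _ _).1.
    have le_d := leq_divM n k.+1; have le_q := leq_div n k.+1.
    rewrite /output_step.
    do 4 (seq_step; rewrite ?R0' ?R4; first lia).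
    seq_step; rewrite ?Mk; [lia | by case: (reach _ _); lia |].
    seq_step; first by case: (reach _ _); lia.
    have okE : (n - n %/ k.+1 * k.+1 + reach n.+1 k.+1 < 1) = ok k.+1.
      rewrite /ok dvdn_eq; case: (reach _ _); lia.
    have outS : out k.+1 =
        if ok k.+1 then rcons (out k) k.+1 else out k.
      rewrite /out; have -> : iota 1 k.+1 = rcons (iota 1 k) k.+1.
        by rewrite -(addn1 k) iotaD cats1 addnC.
      by rewrite filter_rcons.
    apply: runs_seq; apply: runs_if; rewrite /= !updE /= R2' ?[1 <= _]leqNgt okE => ok_k.
      seq_step; first lia.
      step; rewrite R2'; first lia.
      step; rewrite R4 R2'; first lia.
      split=> //; rewrite outS ok_k; split; rewrite ?updE /=.
      + by rewrite addn1.
      + by rewrite size_rcons R11' addn1.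
      + rewrite addn1 mkseqS updE eqxx; congr rcons; rewrite -outM.
        by apply/eq_in_map => j; rewrite mem_iota /= updE => lt_j; rewrite ifF //; lia.
      + by repeat apply: agree_upd => //.
      + by apply: flags_at_low => //; lia.
    step; rewrite R4 R2'; first lia.
    split=> //; rewrite outS (negbTE ok_k); split; rewrite ?updE //=.
    + by rewrite addn1.
    + by repeat apply: agree_upd => //.
  - by move=> R' M' [-> _ _ ag _]; rewrite (ag 3) ?R3.
  - by split=> //; rewrite ?updE /= ?R11 //; solve_agree.
move=> t R' M' [le_t [_ R11' outM ag _]].
have le_out : R' 11 <= n by rewrite R11' size_filter -[leqRHS](size_iota 1 n) count_size.
have R1' : R' 1 = 0 by rewrite (ag 1).
step; rewrite R1' addn0; first lia.
by split=> //; move: le_t; rewrite sum_nat_const card_ord; lia.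
Qed.

Definition full_periods_cmd : cmd := (mark_phase sigma;; sieve_phase;; output_phase).

Lemma full_periods_computes :
  exists2 t, t <= sigma * (26 * n + 11) + 23 * n
                  + 11 * (\sum_(2 <= p < n.+1 | prime p) n %/ p) + 12
    & ram_computes cells bits (rcons (compile 0 full_periods_cmd) Halt) x t periods.
Proof.
set P := rcons _ _.
have code_P : code_at P 0 (compile 0 full_periods_cmd).
  move=> i y iP; rewrite /P -cats1 onth_cat ifT //.
  by rewrite add0n -onthTE iP.
have run : runs full_periods_cmd (upd (fun=> 0) 0 n) (nth 0 x) (fun t R' M' =>
    [/\ t <= sigma * (26 * n + 11) + 23 * n
                  + 11 * (\sum_(2 <= p < n.+1 | prime p) n %/ p) + 12,
        R' 0 <= n & mkseq M' (R' 0) = periods]).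
  rewrite /full_periods_cmd; apply: runs_seq; apply: runs_weaken.
    (* Cells beyond the input are 0, so both tables start out empty. *)
    apply: (@mark_phase_runs _ _ xpred0) => // j /andP[j_gt0 _].
    by rewrite !nth_default //; lia.
  move=> t1 R1 M1 [le_t1 R12 ag1 flM1]; apply: runs_seq; apply: runs_weaken.
    by apply: sieve_phase_runs flM1; rewrite // ?(ag1 0) ?(ag1 1).
  move=> t2 R2 M2 [le_t2 R23 ag2 flM2]; apply: runs_weaken.
    apply: output_phase_runs flM2; rewrite // ?(ag2 0) ?(ag2 1) ?(ag2 2) ?(ag2 11) //
      ?(ag1 0) ?(ag1 1) ?(ag1 11) //.
  move=> t3 R3 M3 [le_t3 R30 outM]; split=> //; lia.
have [t [R' [M' [steps [le_t R'0 outM]]]]] := run _ _ code_P.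
exists t => //; split; [lia | lia | |].
  by apply: sub_all letter_lt => a lt_a; lia.
exists (Config (0 + csize full_periods_cmd) R' M'); split=> //=; lia.
Qed.

End Machine.

(** * Asymptotics *)

Lemma ltn_up_log (k n : nat) : 2 ^ k < n -> k < up_log 2 n.
Proof.
move=> lt_n; rewrite -(@ltn_exp2l 2) //; apply: leq_trans lt_n _; exact: up_logP.
Qed.

Section Logarithms.

Variable R : realType.
Local Open Scope ring_scope.

(** From [ln (1 + y) <= y] at [y = - (1 / 2)], since [ln 2^-1 = - ln 2]. *)
Lemma ln2_ge_half : 1 / 2 <= ln (2 : R).
Proof.
have : ln (1 + - (1 / 2) : R) <= - (1 / 2) by apply: le_ln1Dx; lra.
have -> : 1 + - (1 / 2) = 2^-1 :> R by lra.
by rewrite lnV ?posrE //; lra.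
Qed.

Lemma half_exp_le_ln (k : nat) (y : R) : 2 ^+ k <= y -> k%:R / 2 <= ln y.
Proof.
move=> le_y; have k2 : 0 < 2 ^+ k :> R by rewrite exprn_gt0.
apply: (@le_trans _ _ (ln (2 ^+ k))); last first.
  by rewrite ler_ln // posrE // (lt_le_trans k2).
by rewrite lnXn // -[ln 2 *+ k]mulr_natl ler_wpM2l // -[_^-1]mul1r ln2_ge_half.
Qed.

Lemma pred_up_log_le_ln (n : nat) :
  (1 < n)%N -> (up_log 2 n).-1%:R / 2 <= ln (n%:R : R).
Proof.
move=> n_gt1; apply: half_exp_le_ln; rewrite -natrX ler_nat ltnW //.
exact: up_log_gtn.
Qed.

(** Here [up_log 2 n] is at least 2, so doubling its predecessor makes up for the rounding. *)
Lemma up_log_le_ln (n : nat) : (2 < n)%N -> (up_log 2 n)%:R <= 4 * ln (n%:R : R).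
Proof.
move=> n_gt2; have := pred_up_log_le_ln (ltnW n_gt2).
have : (up_log 2 n <= 2 * (up_log 2 n).-1)%N by have := @ltn_up_log 1 n n_gt2; lia.
by rewrite -(ler_nat R) natrM; lra.
Qed.

(** The threshold [256 = 2 ^ 8] makes [L] exceed [8 = 2 ^ 3] and [r] exceed 3, so that
    [r <= 2 * r.-2]. Two units are lost: one to rounding, one to the factor 1/2 between [L.-1] and
    [ln n]. *)
Lemma up_log_up_log_le_ln_ln (n : nat) : (256 < n)%N ->
  (up_log 2 (up_log 2 n))%:R <= 4 * ln (ln (n%:R : R)).
Proof.
move=> n_big; set L := up_log 2 n; set r := up_log 2 L.
have L_big : (8 < L)%N by apply: ltn_up_log.
have r_big : (3 < r)%N by apply: ltn_up_log.
have ln_n : 2 ^+ r.-2 <= ln (n%:R : R).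
  apply: le_trans (pred_up_log_le_ln _); last lia.
  have lt_L : (2 ^ r.-1 < L)%N by apply: up_log_gtn => //; lia.
  have : (2 * 2 ^ r.-2 <= L.-1)%N.
    by rewrite -expnS prednK; lia.
  by rewrite -(ler_nat R) natrM natrX; lra.
have := half_exp_le_ln ln_n.
have : (r <= 2 * r.-2)%N by lia.
by rewrite -(ler_nat R) natrM; lra.
Qed.

End Logarithms.

Local Open Scope classical_set_scope.

(** The maximum with 1 supplies the positive constant that [eqO_exP] asks for. *)
Lemma eqO_nat (R : realType) (f g : nat -> R) (N : nat) (k : R) :
  (forall n, (N <= n)%N -> (`|f n| <= k * `|g n|)%R) -> (f =O_\oo g)%R.
Proof.
move=> le_fg; apply/eqO_exP; exists (Num.max k 1)%R.
  by rewrite lt_max ltr01 orbT.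
exists N => // n /= /le_fg /le_trans; apply.
by apply: ler_wpM2r => //; rewrite le_max lexx.
Qed.

Theorem theorem1 (sigma : nat) :
  exists (P : program) (time space bits : nat -> nat),
    (forall w : seq 'I_sigma,
       exists (t : nat) (ps : seq nat),
         [/\ t <= time (size w),
             ram_computes (space (size w)) (bits (size w)) P
               [seq nat_of_ord a | a <- w] t ps,
             uniq ps &
             forall p : nat, p \in ps <-> full_abelian_period w p])
    /\
    (forall R : realType,
       [/\ (fun n : nat => (time n)%:R : R)%R
             =O_\oo (fun n : nat => n%:R * ln (ln n%:R) : R)%R,
           (fun n : nat => (space n)%:R : R)%R
             =O_\oo (fun n : nat => n%:R : R)%R &
           (fun n : nat => (bits n)%:R : R)%R
             =O_\oo (fun n : nat => ln n%:R : R)%R]).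
Proof.
exists (rcons (compile 0 (full_periods_cmd sigma)) Halt).
exists (fun n => sigma * (26 * n + 11) + 23 * n
                 + 11 * (n * (up_log 2 (up_log 2 n)).*2.+1) + 12).
exists (fun n => 3 * n + 1), (fun n => 2 * up_log 2 n + sigma + 3).
split=> [w|R].
  set x := [seq nat_of_ord a | a <- w].
  have size_x : size x = size w by rewrite size_map.
  have lt_x : all (fun a => a < sigma) x by apply/allP => _ /mapP[a _ ->].
  (* With [u] the power of two above the length and [s = 2 ^ sigma], the right side is
     [8 * u * u * s], and every summand on the left is at most a small multiple of [u * u * s]. *)
  have word_size : size x * size x + 3 * size x + sigma + 3 <=
      2 ^ (2 * up_log 2 (size w) + sigma + 3).
    have := @up_logP 2 (size w) isT; rewrite -size_x.
    rewrite !expnD expn0 muln1 -[2 ^ 3]/8.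
    have : 0 < 2 ^ up_log 2 (size x) by rewrite expn_gt0.
    have := ltn_expl sigma (isT : 1 < 2).
    move: (2 ^ sigma) (2 ^ up_log 2 _) => s u lt_s u_gt0 le_u.
    have le_uu : u <= u * u by rewrite leq_pmulr.
    have : size x * size x <= u * u by rewrite leq_mul.
    have : s <= u * u * s by rewrite leq_pmull // (leq_trans u_gt0).
    have : u * u <= u * u * s by rewrite leq_pmulr // (leq_ltn_trans _ lt_s).
    by lia.
  have [t le_t comp_t] := full_periods_computes lt_x word_size.
  exists t, (periods sigma x); split.
  - apply: leq_trans le_t _; rewrite size_x leq_add2r leq_add2l leq_pmul2l //.
    exact: sum_prime_divn.
  - by rewrite -{1}size_x.
  - by rewrite filter_uniq // iota_uniq.
  - exact: periods_full_abelian_period.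
split.
- apply: (@eqO_nat _ _ _ 257 (4 * (27 * sigma + 60)%:R)%R) => n n_big.
  have lnln := @up_log_up_log_le_ln_ln R n n_big.
  rewrite ger0_norm ?ler0n //; apply: le_trans (ler_wpM2l _ (ler_norm _)); last first.
    by rewrite mulr_ge0 ?ler0n.
  set r := up_log 2 (up_log 2 n) in lnln *.
  have r_gt0 : 0 < r by do 2 apply: ltn_up_log => //; apply: leq_trans n_big.
  (* Since [11 <= n] and [1 <= r], the terms in [sigma] fit in [27 * sigma * (n * r)]; the others
     amount to 23 + 22 + 11 times [n * r] plus 12, within [60 * (n * r)]. *)
  have le_time : sigma * (26 * n + 11) + 23 * n + 11 * (n * r.*2.+1) + 12 <=
      (27 * sigma + 60) * (n * r).
    have : n <= n * r by rewrite leq_pmulr.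
    have : 11 * sigma <= n * sigma by rewrite leq_mul2r (leq_trans _ n_big) ?orbT.
    have : sigma * n <= sigma * (n * r) by rewrite leq_mul2l leq_pmulr ?orbT.
    by move: n_big; clear; lia.
  have := le_time; rewrite -(ler_nat R) => /le_trans; apply.
  rewrite !natrM -/r.
  have -> : (4 * (27 * sigma + 60)%:R * (n%:R * ln (ln n%:R)) =
      (27 * sigma + 60)%:R * (n%:R * (4 * ln (ln n%:R))) :> R)%R by ring.
  by do 2 (apply: ler_wpM2l; first exact: ler0n).
- apply: (@eqO_nat _ _ _ 1 4%R) => n n_gt0.
  rewrite !ger0_norm ?ler0n //.
  have : 3 * n + 1 <= 4 * n by lia.
  by rewrite -(ler_nat R) [(4 * n)%:R%R]natrM.
- apply: (@eqO_nat _ _ _ 3 (4 * (sigma + 5)%:R)%R) => n n_gt2.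
  have le_ln := @up_log_le_ln R n n_gt2.
  rewrite ger0_norm ?ler0n //; apply: le_trans (ler_wpM2l _ (ler_norm _)); last first.
    by rewrite mulr_ge0 ?ler0n.
  have L_gt0 : 0 < up_log 2 n by apply: ltn_up_log; apply: leq_trans n_gt2.
  (* The constants [sigma] and 3 are absorbed because the logarithm is at least 1. *)
  have : 2 * up_log 2 n + sigma + 3 <= (sigma + 5) * up_log 2 n.
    have : sigma <= sigma * up_log 2 n by rewrite leq_pmulr.
    by rewrite mulnDl; move: (sigma * _); lia.
  rewrite -(ler_nat R) => /le_trans; apply; rewrite natrM.
  rewrite [(4 * _)%R]mulrC -mulrA; apply: ler_wpM2l => //; exact: ler0n.
Qed.
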